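(* Let $a_i,b_i,c_i,x_i,y_i\in\mathbb{C}$ and $d_i,e_i\in\mathbb{C}\setminus\{q^{-m}:m\ge0\}$ for $i=1,2$, and let $t\in\mathbb{C}$. Assume $x_1\neq0$ and $|t|\max(|x_1|,|y_1|)\max(|x_2|,|y_2|)<1$. Then $$\sum_{n=0}^\infty\phi_n^{(a_1,b_1,c_1;d_1,e_1)}(x_1,y_1|q)\,\phi_n^{(a_2,b_2,c_2;d_2,e_2)}(x_2,y_2|q)\frac{t^n}{(q;q)_n}$$ $$=\frac{1}{(x_1x_2t;q)_\infty}\sum_{n=0}^\infty\frac{(a_2,b_2,c_2;q)_n(x_1y_2t)^n}{(q,d_2,e_2;q)_n}\sum_{j=0}^{n}\frac{(q^{n-j+1},x_1x_2t,a_1,b_1,c_1;q)_j}{(q,d_1,e_1;q)_j}\Big(\frac{y_1}{x_1}\Big)^j\sum_{l=0}^\infty\frac{(a_1q^j,b_1q^j,c_1q^j;q)_l}{(q,d_1q^j,e_1q^j;q)_l}(x_2y_1t)^l.$$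
   Context: Throughout, $0<q<1$. $(\alpha;q)_0=1$, $(\alpha;q)_n=\prod_{j=0}^{n-1}(1-\alpha q^j)$, $(\alpha;q)_\infty=\prod_{j\ge0}(1-\alpha q^j)$, and $(\alpha_1,\dots,\alpha_r;q)_n=\prod_i(\alpha_i;q)_n$. $\begin{bmatrix}n\\k\end{bmatrix}=\frac{(q;q)_n}{(q;q)_k(q;q)_{n-k}}$. $$\phi_n^{(a,b,c;d,e)}(x,y|q)=\sum_{k=0}^n\begin{bmatrix}n\\k\end{bmatrix}\frac{(a,b,c;q)_k}{(d,e;q)_k}x^{n-k}y^k.$$ *)

(* Defs.v *)
From HB Require Import structures.
From mathcomp Require Import all_boot all_order all_algebra.
From mathcomp Require Import complex.
From mathcomp Require Import all_classical all_reals all_analysis.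
Set Implicit Arguments. Unset Strict Implicit. Unset Printing Implicit Defensive.
Import Order.TTheory GRing.Theory Num.Theory.
Import numFieldNormedType.Exports.
Local Open Scope ring_scope.
Local Open Scope complex_scope.

(* The complex numbers C = Cplx R for R : realType, seen as a numClosedFieldType
   (this makes MathComp-Analysis' topology/normed structure available). *)
Definition Cplx (R : realType) : numClosedFieldType := R[i].

Definition qpoch {R : realType} (a q : Cplx R) (n : nat) : Cplx R :=
  \prod_(j < n) (1 - a * q ^+ j).

Definition qpoch_inf {R : realType} (a q : Cplx R) : Cplx R :=
  limn (fun n => qpoch a q n).

Definition qbinom {R : realType} (q : Cplx R) (n k : nat) : Cplx R :=
  qpoch q q n / (qpoch q q k * qpoch q q (n - k)).

Definition qphi {R : realType} (a b c d e x y q : Cplx R) (n : nat) : Cplx R :=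
  \sum_(k < n.+1) qbinom q n k
     * (qpoch a q k * qpoch b q k * qpoch c q k) / (qpoch d q k * qpoch e q k)
     * x ^+ (n - k) * y ^+ k.

Definition not_qneg_pow {R : realType} (q d : Cplx R) : Prop :=
  forall m : nat, d != (q ^+ m)^-1.

(* Main.v *)
Require Import Defs.
From HB Require Import structures.
From mathcomp Require Import all_boot all_order all_algebra.
From mathcomp Require Import complex.
From mathcomp Require Import all_classical all_reals all_analysis.
From mathcomp Require Import zify ring.
Set Implicit Arguments.
Unset Strict Implicit.
Import Order.TTheory GRing.Theory Num.Theory.
Import numFieldNormedType.Exports.
Local Open Scope ring_scope.
Local Open Scope complex_scope.

(** Write u_k and v_k for the coefficients (a,b,c;q)_k/(d,e;q)_k of the two
    polynomials. Expanding the second one by the q-Vandermonde identity, with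
    n split as k + (n - k) where k is the summation index of the first one,
    turns the left-hand side into the quadruple series of
      T(j,p,l,s) = u_(j+l) v_(j+p) x1^(p+s) y1^(j+l) x2^(l+s) y2^(j+p)
                   t^(j+p+l+s) q^(js) / ((q)_j (q)_p (q)_l (q)_s)
    summed by total degree n = j+p+l+s, where k = j+l. Since u and v are
    bounded, |T| is at most K r^(j+p+l+s) with
    r = |t| max(|x1|,|y1|) max(|x2|,|y2|) < 1, so that Tannery's theorem gives
    the iterated sum over j, p, l, s. Summing over s by Euler's identity
      sum_s (z q^j)^s/(q)_s = (z;q)_j / (z;q)_oo,  z = x1 x2 t,
    and regrouping by j + p gives the right-hand side. *)

(** * Series of complex numbers dominated by a geometric series *)

Local Open Scope classical_set_scope.

Lemma Cplx_ge0E (R : realType) (x : Cplx R) : 0 <= x -> exists2 a : R, 0 <= a & x = a%:C.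
Proof.
move=> x0; have xr : x \is Num.real by rewrite realE x0.
exists (complex.Re x); last by rewrite RRe_real.
by rewrite -ler0c RRe_real.
Qed.

Lemma cvg_real_complex (R : realType) (u : nat -> R) (a : R) :
  u n @[n --> \oo] --> a -> ((u n)%:C : Cplx R) @[n --> \oo] --> (a%:C : Cplx R).
Proof.
move=> ua; apply/cvgrPdist_lt => e e0.
have [b b0 eb] := Cplx_ge0E (ltW e0).
have {}b0 : 0 < b by rewrite -ltcR -eb.
move/cvgrPdist_lt : ua => /(_ _ b0); apply: filterS => n h.
by rewrite -rmorphB /= normc_def /= expr0n /= addr0 sqrtr_sqr eb ltcR.
Qed.

Lemma cvg_complex (R : realType) (u : nat -> Cplx R) (a b : R) :
  complex.Re (u n) @[n --> \oo] --> a -> complex.Im (u n) @[n --> \oo] --> b ->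
  u n @[n --> \oo] --> ((a +i* b)%C : Cplx R).
Proof.
move=> /cvg_real_complex ua /cvg_real_complex ub.
rewrite (_ : u = fun n => (complex.Re (u n))%:C + 'i%C * (complex.Im (u n))%:C).
  rewrite (complexE (a +i* b)%C) /=.
  by apply: (cvgD ua); apply: cvgMl_tmp.
by apply/funext => n; rewrite -complexE.
Qed.

Lemma cvg_expr_Cplx (R : realType) (r : Cplx R) :
  0 <= r -> r < 1 -> r ^+ n @[n --> \oo] --> (0 : Cplx R).
Proof.
move=> /Cplx_ge0E[a a0 ->]; rewrite ltcR => a1.
have /cvg_expr/cvg_real_complex : `|a| < 1 by rewrite ger0_norm.
by under eq_cvg do rewrite rmorphXn /=.
Qed.

(** The order on [Cplx R] is partial; [B] is real because it dominates a norm, hence comparable with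
    [|l|]. If B < |l|, a term at distance less than |l| - B from [l] would have norm above [B]. *)
Lemma norm_le_cvg (R : realType) (u : nat -> Cplx R) (l B : Cplx R) :
  u n @[n --> \oo] --> l -> (forall n, `|u n| <= B) -> `|l| <= B.
Proof.
move=> ul uB.
have [//|Bl] := real_leP (normr_real l) (ger0_real (le_trans (normr_ge0 _) (uB 0))).
exfalso; move/cvgrPdist_lt : ul => /(_ (`|l| - B)); rewrite subr_gt0 => /(_ Bl)[n _ /(_ n)].
move=> /(_ (leqnn n)) /=; apply/negP; rewrite -real_leNgt ?realB ?normr_real //.
  by rewrite (le_trans _ (lerB_dist _ _))// lerB.
by rewrite (ger0_real (le_trans (normr_ge0 _) (uB 0))).
Qed.

Lemma sum_expr_le (R : realType) (r : Cplx R) (N : nat) :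
  0 <= r -> r < 1 -> \sum_(h < N) r ^+ h <= (1 - r)^-1.
Proof.
move=> r0 r1; have r1' : 0 < 1 - r by rewrite subr_gt0.
rewrite -[leLHS](mulfK (lt0r_neq0 r1')) -[leRHS]mul1r ler_pM2r ?invr_gt0//.
by rewrite mulrC -opprB mulNr -subrX1 opprB lerBlDr lerDl exprn_ge0.
Qed.

Lemma norm_sum_geo (R : realType) (K r : Cplx R) (u : nat -> Cplx R) :
  0 <= r -> r < 1 -> (forall n, `|u n| <= K * r ^+ n) ->
  forall N, `|\sum_(h < N) u h| <= K / (1 - r).
Proof.
(* The bound at n = 0 already forces K >= 0. *)
move=> r0 r1 uK N; have K0 : 0 <= K.
  by rewrite (le_trans (normr_ge0 (u 0)))// (le_trans (uK 0))// expr0 mulr1.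
rewrite (le_trans (ler_norm_sum _ _ _))//.
rewrite (le_trans (ler_sum _ (fun (i : 'I_N) _ => uK i)))// -mulr_sumr.
by rewrite ler_wpM2l// sum_expr_le.
Qed.

(** Real and imaginary parts are bounded by the norm, so each gives a real series dominated by a
    geometric one; the two real limits form the complex limit. *)
Lemma cvg_geo (R : realType) (K r : Cplx R) (u : nat -> Cplx R) :
  0 <= r -> r < 1 -> (forall n, `|u n| <= K * r ^+ n) ->
  cvgn (fun N => \sum_(h < N) u h).
Proof.
move=> r0 r1 uK.
have K0 : 0 <= K.
  by rewrite (le_trans (normr_ge0 (u 0)))// (le_trans (uK 0))// expr0 mulr1.
have [k k0 kE] := Cplx_ge0E K0; have [s s0 sE] := Cplx_ge0E r0.
rewrite {}kE {}sE {r0 K0} in r1 uK *; move: r1; rewrite ltcR => s1.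
have aux (v : nat -> R) : (forall n, `|v n|%:C <= `|u n|) -> cvgn (series v).
  move=> vu; apply: normed_cvg.
  apply: (@series_le_cvg _ _ (geometric k s)) => [n|n|n|].
  - exact: normr_ge0.
  - by rewrite /= mulr_ge0// exprn_ge0.
  - by rewrite -lecR (le_trans (vu n))// (le_trans (uK n))// rmorphM rmorphXn.
  - by apply: is_cvg_geometric_series; rewrite ger0_norm.
have /cvg_ex[a ha] := aux (fun n => complex.Re (u n)) (fun n => normc_ge_Re _).
have /cvg_ex[b hb] : cvgn (series (fun n => complex.Im (u n))).
  apply: aux => n; rewrite normc_def lecR -sqrtr_sqr ler_wsqrtr//.
  by rewrite lerDr sqr_ge0.
apply/cvg_ex; exists (a +i* b)%C; apply: cvg_complex.
- suff -> : (fun N => complex.Re (\sum_(h < N) u h)) = series (fun n => complex.Re (u n)) by [].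
  apply/funext => N; rewrite /series /= big_mkord.
  elim: N => [|N IH]; rewrite ?big_ord0// !big_ord_recr/= -IH.
  by case: (\sum_(h < N) u h) (u N) => [? ?] [? ?].
- suff -> : (fun N => complex.Im (\sum_(h < N) u h)) = series (fun n => complex.Im (u n)) by [].
  apply/funext => N; rewrite /series /= big_mkord.
  elim: N => [|N IH]; rewrite ?big_ord0// !big_ord_recr/= -IH.
  by case: (\sum_(h < N) u h) (u N) => [? ?] [? ?].
Qed.

(** Dominated convergence when both the range and the summands depend on [N]. Cut at a fixed [M]:
    the tail of f N h - g h is small uniformly in [N], and the head is a finite sum of null
    sequences. *)
Lemma tannery (R : realType) (K r : Cplx R) (f : nat -> nat -> Cplx R) (g : nat -> Cplx R) :
  0 <= r -> r < 1 -> (forall N h, `|f N h| <= K * r ^+ h) ->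
  (forall h, f N h @[N --> \oo] --> g h) ->
  \sum_(h < N) f N h @[N --> \oo] --> limn (fun N => \sum_(h < N) g h).
Proof.
move=> r0 r1 fK fg.
have gK h : `|g h| <= K * r ^+ h by apply: norm_le_cvg (fg h) _ => N.
have cg := cvg_geo r0 r1 gK.
have K0 : 0 <= K.
  by rewrite (le_trans (normr_ge0 (g 0)))// (le_trans (gK 0))// expr0 mulr1.
rewrite -[X in _ --> X]add0r.
rewrite (_ : (fun N => _) = fun N => \sum_(h < N) (f N h - g h) + \sum_(h < N) g h); last first.
  by apply/funext => N; rewrite -big_split/=; apply: eq_bigr => i _; rewrite subrK.
apply: cvgD; last exact: cg.
apply/cvgrPdist_lt => e e0.
have e2 : 0 < e / 2 by rewrite divr_gt0.
(* Both [f N h] and [g h] are at most K r^h in norm, hence the doubled constant: c r^M bounds the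
   tail from [M] on. *)
pose c := (K + K) / (1 - r).
have c0 : 0 <= c by apply: divr_ge0; [exact: addr_ge0|rewrite subr_ge0 ltW].
have : c * r ^+ n @[n --> \oo] --> c * 0.
  by apply: cvgMl_tmp; exact: cvg_expr_Cplx.
rewrite mulr0 => /cvgrPdist_lt/(_ _ e2)[M _ /(_ M (leqnn M))]/=.
rewrite sub0r normrN ger0_norm; last exact: mulr_ge0 c0 (exprn_ge0 _ r0).
move=> cM.
have : \sum_(h < M) `|f N h - g h| @[N --> \oo] --> \sum_(h < M) (0 : Cplx R).
  elim: (M) => [|m IH].
    by under eq_cvg do rewrite big_ord0; rewrite big_ord0; exact: cvg_cst.
  under eq_cvg do rewrite big_ord_recr/=; rewrite big_ord_recr/=.
  apply: (cvgD IH).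
  rewrite -(normr0 (Cplx R)) -(subrr (g m)); apply: cvg_norm.
  by apply: cvgB; [exact: fg|exact: cvg_cst].
rewrite big1// => /cvgrPdist_lt/(_ _ e2) H.
near=> N; rewrite sub0r normrN.
have MN : (M <= N)%N by near: N; exact: nbhs_infty_ge.
rewrite -(big_mkord xpredT (fun h => f N h - g h)) (big_cat_nat (leq0n M) MN)//=.
rewrite (splitr e) (le_lt_trans (ler_normD _ _))// ltr_leD//.
  rewrite big_mkord (le_lt_trans (ler_norm_sum _ _ _))//.
  have : `|0 - \sum_(h < M) `|f N h - g h| | < e / 2 by near: N.
  by rewrite sub0r normrN ger0_norm// sumr_ge0.
rewrite (le_trans _ (ltW cM))// -{1}[M]add0n big_addn big_mkord.
rewrite /c mulrAC; apply: (norm_sum_geo (u := fun i => f N (i + M)%N - g (i + M)%N)) => // n.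
rewrite -mulrA -exprD addnC mulrDl (le_trans (ler_normB _ _))// lerD//.
Unshelve. all: by end_near.
Qed.

(** * Bounds on q-shifted factorials and the q-Vandermonde identity *)

Lemma qpoch0 (R : realType) (a q : Cplx R) : qpoch a q 0 = 1.
Proof. by rewrite /qpoch big_ord0. Qed.

Lemma qpochS (R : realType) (a q : Cplx R) n :
  qpoch a q n.+1 = qpoch a q n * (1 - a * q ^+ n).
Proof. by rewrite /qpoch big_ord_recr. Qed.

Lemma qpochD (R : realType) (a q : Cplx R) j l :
  qpoch a q (j + l) = qpoch a q j * qpoch (a * q ^+ j) q l.
Proof.
elim: l => [|l IH]; first by rewrite addn0 qpoch0 mulr1.
by rewrite addnS !qpochS IH exprD !mulrA.
Qed.

Lemma not_qneg_pow_neq0 (R : realType) (q d : Cplx R) :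
  q != 0 -> not_qneg_pow q d -> forall m, 1 - d * q ^+ m != 0.
Proof.
move=> q0 hd m; rewrite subr_eq0; apply/eqP => h; move/eqP : (hd m); apply.
by apply: (mulIf (expf_neq0 m q0)); rewrite -h mulVf// expf_neq0.
Qed.

Lemma qpoch_neq0 (R : realType) (q d : Cplx R) :
  (forall m, 1 - d * q ^+ m != 0) -> forall n, qpoch d q n != 0.
Proof. by move=> hd n; apply/prodf_neq0 => i _. Qed.

Lemma qq_neq0 (R : realType) (q : Cplx R) :
  0 <= q -> q < 1 -> forall m, 1 - q * q ^+ m != 0.
Proof.
by move=> q0 q1 m; rewrite -exprS subr_eq0 eq_sym lt_eqF// exprn_ilt1.
Qed.

(** Since 1 + x <= exp x, the product is at most the exponential of a geometric sum. *)
Lemma prod_bounded (R : realType) (K q : Cplx R) (w : nat -> Cplx R) :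
  0 <= q -> q < 1 -> (forall j, `|w j| <= K * q ^+ j) ->
  exists A : Cplx R, forall n, `|\prod_(j < n) (1 + w j)| <= A.
Proof.
move=> q0 q1 wK.
have K0 : 0 <= K.
  by rewrite (le_trans (normr_ge0 (w 0)))// (le_trans (wK 0))// expr0 mulr1.
have [k k0 kE] := Cplx_ge0E K0; have [s s0 sE] := Cplx_ge0E q0.
exists (expR (k / (1 - s)))%:C => n.
have : `|\prod_(j < n) (1 + w j)| <= (expR (\sum_(j < n) k * s ^+ j))%:C.
  elim: n => [|n IH]; first by rewrite !big_ord0 normr1 expR0.
  rewrite !big_ord_recr/= expRD rmorphM normrM ler_pM//.
  rewrite (le_trans (ler_normD _ _))// normr1.
  apply: (@le_trans _ _ (1 + k * s ^+ n)%:C); last by rewrite lecR expR_ge1Dx.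
  by rewrite rmorphD lerD2l rmorphM rmorphXn/= -kE -sE.
move/le_trans; apply; rewrite lecR ler_expR -lecR.
rewrite rmorph_sum fmorph_div/= rmorphB/= -kE -sE rmorph1.
under eq_bigr do rewrite rmorphM rmorphXn/= -kE -sE.
by rewrite -mulr_sumr ler_wpM2l// sum_expr_le.
Qed.

Lemma qpoch_bounded (R : realType) (a q : Cplx R) :
  0 <= q -> q < 1 -> exists A : Cplx R, forall n, `|qpoch a q n| <= A.
Proof.
move=> q0 q1; have [|A hA] := @prod_bounded R `|a| q (fun j => - (a * q ^+ j)) q0 q1.
  by move=> j; rewrite normrN normrM (ger0_norm (exprn_ge0 _ q0)).
by exists A.
Qed.

(** Write 1/(1 - d q^j) = 1 + d q^j/(1 - d q^j). The correction is geometrically small because 1/(1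
    - d q^j) is bounded, being convergent to 1. *)
Lemma qpoch_inv_bounded (R : realType) (d q : Cplx R) :
  0 <= q -> q < 1 -> (forall m, 1 - d * q ^+ m != 0) ->
  exists A : Cplx R, forall n, `|(qpoch d q n)^-1| <= A.
Proof.
move=> q0 q1 hd.
have [D hD] : exists D : Cplx R, forall m, `|(1 - d * q ^+ m)^-1| <= D.
  have : cvgn (fun m => (1 - d * q ^+ m)^-1 : Cplx R).
    apply/cvg_ex; exists (1 - d * 0)^-1; apply: cvgV.
      by rewrite mulr0 subr0 oner_eq0.
    apply: cvgB; first exact: cvg_cst.
    by apply: cvgMl_tmp; exact: cvg_expr_Cplx.
  move/cvg_seq_bounded => [M [Mr hM]]; exists (M + 1) => m.
  by apply: hM => //; rewrite ltrDl.
have [|A hA] := @prod_bounded R (`|d| * D) q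
  (fun j => d * q ^+ j / (1 - d * q ^+ j)) q0 q1.
  move=> j; rewrite 2!normrM (ger0_norm (exprn_ge0 _ q0)).
  by rewrite mulrAC ler_wpM2r ?exprn_ge0// ler_wpM2l.
exists A => n; apply: le_trans (hA n); rewrite le_eqVlt; apply/orP; left.
apply/eqP; congr (`| _ |); rewrite /qpoch -prodfV; apply: eq_bigr => i _.
by apply: (mulIf (hd i)); rewrite mulVf// mulrDl mul1r divfK// subrK.
Qed.

Section finite_identities.
Context {R : realType} (q : Cplx R).
Hypothesis qn0 : forall n, qpoch q q n != 0.

(** The q-Pascal rule in row n = m + i + 1; parametrizing by [i] keeps every difference of indices
    explicit and untruncated. *)
Lemma qbinom_pascal m i :
  qbinom q (m + i.+1).+1 m.+1
  = qbinom q (m + i.+1) m.+1 + q ^+ i.+1 * qbinom q (m + i.+1) m.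
Proof.
rewrite /qbinom.
have -> : ((m + i.+1).+1 - m.+1 = i.+1)%N by lia.
have -> : ((m + i.+1) - m.+1 = i)%N by lia.
have -> : ((m + i.+1) - m = i.+1)%N by lia.
have := qn0 m.+1; have := qn0 i.+1; rewrite !(qpochS q q).
rewrite !mulf_eq0 !negb_or => /andP[hi hi'] /andP[hm hm'].
rewrite exprD exprS; field.
by rewrite hi hi' hm hm'.
Qed.

Lemma qbinom0 n : qbinom q n 0 = 1.
Proof. by rewrite /qbinom qpoch0 mul1r subn0 divff. Qed.

Lemma qbinomnn n : qbinom q n n = 1.
Proof. by rewrite /qbinom subnn qpoch0 mulr1 divff. Qed.

(** The q-Pascal rule summed against [g]: it treats the interior indices, while the two end terms
    agree because their coefficients are 1. *)
Lemma qbinom_sumS n (g : nat -> Cplx R) :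
  \sum_(m < n.+2) qbinom q n.+1 m * g m
  = \sum_(m < n.+1) qbinom q n m * (g m + q ^+ (n - m) * g m.+1).
Proof.
under [RHS]eq_bigr do rewrite mulrDr.
rewrite big_split/= big_ord_recl big_ord_recr/= [X in _ = X + _]big_ord_recl.
rewrite [X in _ = _ + X]big_ord_recr/= !qbinom0 !qbinomnn subnn expr0 !mul1r.
rewrite -!addrA; congr (_ + _); rewrite !addrA; congr (_ + _).
rewrite -big_split/=; apply: eq_bigr => i _; rewrite /bump !add1n.
case: i => i /= ltin; have -> : n = (i + (n - i.+1).+1)%N by lia.
rewrite qbinom_pascal mulrDl mulrA.
have -> : (i + (n - i.+1).+1 - i = (n - i.+1).+1)%N by lia.
by rewrite [q ^+ _ * _]mulrC.
Qed.

(* The q-Vandermonde identity, tested against an arbitrary sequence [g]. *)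
Lemma qbinom_vandermonde k N (g : nat -> Cplx R) :
  \sum_(m < (k + N).+1) qbinom q (k + N) m * g m
  = \sum_(j < k.+1) \sum_(p < N.+1)
      qbinom q k j * qbinom q N p * q ^+ (j * (N - p)) * g (j + p)%N.
Proof.
elim: k g => [|k IH] g.
  rewrite [RHS]big_ord_recl big_ord0 addr0 add0n; apply: eq_bigr => p _.
  by rewrite qbinom0 mul1r mul0n expr0 mulr1.
rewrite addSn qbinom_sumS.
(* The arbitrary test sequence pays off here: the hypothesis is applied to the sequence produced by
   raising the top index. *)
rewrite (IH (fun m => g m + q ^+ (k + N - m) * g m.+1)).
rewrite exchange_big [RHS]exchange_big/=; apply: eq_bigr => p _.
transitivity (qbinom q N p *
   \sum_(j < k.+2) qbinom q k.+1 j * (q ^+ (j * (N - p)) * g (j + p)%N)); last first.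
  by rewrite mulr_sumr; apply: eq_bigr => j _; ring.
rewrite (qbinom_sumS _ (fun j => q ^+ (j * (N - p)) * g (j + p)%N)) mulr_sumr.
apply: eq_bigr => j _.
(* The weight splits: q^(k-j) is the one that [qbinom_sumS] produces in [j], and q^(N-p) raises
   q^(j(N-p)) to q^((j+1)(N-p)). *)
have -> : (k + N - (j + p) = (k - j) + (N - p))%N.
  by have := ltn_ord j; have := ltn_ord p; lia.
by rewrite addSn mulSn !exprD; ring.
Qed.

End finite_identities.

(** * Euler's identity *)

Lemma cvg_dist_geo (R : realType) (K r : Cplx R) (u : nat -> Cplx R) (l : Cplx R) :
  0 <= r -> r < 1 -> (forall n, `|u n - l| <= K * r ^+ n) ->
  u n @[n --> \oo] --> l.
Proof.
move=> r0 r1 uK; apply/cvgrPdist_le => e e0.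
have : K * r ^+ n @[n --> \oo] --> K * 0 by apply: cvgMl_tmp; exact: cvg_expr_Cplx.
rewrite mulr0 => /cvgrPdist_le/(_ _ e0); apply: filterS => n.
rewrite sub0r normrN distrC; apply: le_trans.
by rewrite (le_trans (uK n))// ger0_norm// (le_trans (normr_ge0 _) (uK n)).
Qed.

Lemma limn_unique (R : realType) (u : nat -> Cplx R) (l : Cplx R) :
  u n @[n --> \oo] --> l -> limn u = l.
Proof. by apply: cvg_lim; exact: norm_hausdorff. Qed.

Section euler.
Context {R : realType} (q : Cplx R).
Hypotheses (q0 : 0 <= q) (q1 : q < 1).

(* Equal to 1/(z;q)_oo for |z| < 1, see [qpoch_infE] below. *)
Definition qexp (z : Cplx R) : Cplx R :=
  limn (fun N => \sum_(s < N) z ^+ s / qpoch q q s).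

Let qqn0 n : qpoch q q n != 0.
Proof. exact: qpoch_neq0 (qq_neq0 q0 q1) n. Qed.

Lemma cvg_qexp z : `|z| < 1 ->
  \sum_(s < N) z ^+ s / qpoch q q s @[N --> \oo] --> qexp z.
Proof.
move=> z1; have [A hA] := qpoch_inv_bounded q0 q1 (qq_neq0 q0 q1).
apply: (cvg_geo (K := A) (u := fun s => z ^+ s / qpoch q q s) (normr_ge0 z) z1) => n.
by rewrite normrM normrX mulrC ler_wpM2r// exprn_ge0.
Qed.

(** In the difference of the two series, (1 - q^s)/(q;q)_s collapses to 1/(q;q)_(s-1), which leaves
    z times the original series. *)
Lemma qexp_shift z : `|z| < 1 -> qexp (z * q) = (1 - z) * qexp z.
Proof.
move=> z1; have zq1 : `|z * q| < 1.
  by rewrite normrM (ger0_norm q0) (le_lt_trans _ z1)// ler_piMr// ltW.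
suff : qexp z - qexp (z * q) = z * qexp z.
  by rewrite mulrBl mul1r => <-; rewrite opprB addrC subrK.
(* Partial sums are taken with N + 1 terms: the one at s = 0 cancels in the difference and N terms
   remain. *)
have cS w : `|w| < 1 -> \sum_(s < N.+1) w ^+ s / qpoch q q s @[N --> \oo] --> qexp w.
  by move=> /cvg_qexp; rewrite -(cvg_shiftS (fun N => \sum_(s < N) w ^+ s / qpoch q q s)).
rewrite -(limn_unique (cvgB (cS _ z1) (cS _ zq1))).
apply: limn_unique.
rewrite (_ : (fun N => _) = fun N => z * \sum_(s < N) z ^+ s / qpoch q q s).
  by apply: cvgMl_tmp; exact: cvg_qexp.
apply/funext => N; rewrite !fctE -sumrB big_ord_recl/= !expr0 subrr add0r mulr_sumr.
apply: eq_bigr => i _; rewrite /bump add1n.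
have := qqn0 i.+1; rewrite qpochS mulf_eq0 negb_or => /andP[hi hi'].
by rewrite exprMn !exprS; field; rewrite hi hi'.
Qed.

Lemma norm_mul_expr_lt1 z j : `|z| < 1 -> `|z * q ^+ j| < 1.
Proof.
move=> z1; rewrite normrM (ger0_norm (exprn_ge0 _ q0)) (le_lt_trans _ z1)//.
by rewrite ler_piMr// exprn_ile1// ltW.
Qed.

Lemma qexp_shiftn z j : `|z| < 1 -> qexp (z * q ^+ j) = qpoch z q j * qexp z.
Proof.
move=> z1; elim: j => [|j IH]; first by rewrite expr0 mulr1 qpoch0 mul1r.
rewrite exprSr mulrA (qexp_shift (norm_mul_expr_lt1 j z1)) IH qpochS.
by rewrite mulrA [_ * qpoch _ _ _]mulrC.
Qed.

(** With w = z q^n, the series minus its constant term 1 is at most A |w|/(1 - |z|), which decays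
    like q^n. *)
Lemma cvg_qexp1 z : `|z| < 1 -> qexp (z * q ^+ n) @[n --> \oo] --> (1 : Cplx R).
Proof.
move=> z1; have [A hA] := qpoch_inv_bounded q0 q1 (qq_neq0 q0 q1).
have A0 : 0 <= A := le_trans (normr_ge0 _) (hA 0).
apply: (cvg_dist_geo (K := A * `|z| / (1 - `|z|)) q0 q1) => n.
set w := z * q ^+ n; have w1 : `|w| < 1 by exact: norm_mul_expr_lt1.
have wE : `|w| = `|z| * q ^+ n by rewrite normrM (ger0_norm (exprn_ge0 _ q0)).
have : \sum_(s < N.+1) w ^+ s / qpoch q q s - 1 @[N --> \oo] --> qexp w - 1.
  have := cvg_qexp w1; rewrite -(cvg_shiftS (fun N => \sum_(s < N) w ^+ s / qpoch q q s)).
  by move=> cw; exact: (cvgB cw (cvg_cst _)).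
move/norm_le_cvg; apply => N; rewrite big_ord_recl/= expr0 qpoch0 divr1.
have -> : A * `|z| / (1 - `|z|) * q ^+ n = A * `|w| / (1 - `|z|).
  by rewrite wE mulrAC mulrA.
rewrite addrC addKr.
apply: (norm_sum_geo (u := fun s => w ^+ (bump 0 s) / qpoch q q (bump 0 s))) => // s.
rewrite /bump add1n exprS normrM mulrC normrM normrX -mulrA.
apply: (ler_pM (normr_ge0 _) _ (hA _)); first by rewrite -normrX -normrM normr_ge0.
by rewrite ler_wpM2l// lerXn2r ?nnegrE// wE ler_piMr// exprn_ile1// ltW.
Qed.

(** A zero at z would propagate to all z q^n by [qexp_shiftn], against the limit 1. *)
Lemma qexp_neq0 z : `|z| < 1 -> qexp z != 0.
Proof.
move=> z1; apply/eqP => z0; have := cvg_qexp1 z1.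
under eq_cvg do rewrite qexp_shiftn// z0 mulr0.
move=> c1; have := oner_neq0 (Cplx R); rewrite -(limn_unique c1) => /eqP; apply.
by apply: limn_unique; exact: cvg_cst.
Qed.

(** Euler's identity: (z;q)_n = qexp (z q^n) / qexp z, whose numerator tends to 1. *)
Lemma qpoch_infE z : `|z| < 1 -> (qpoch_inf z q)^-1 = qexp z.
Proof.
move=> z1; rewrite -[RHS]invrK; congr (_^-1); apply: limn_unique.
rewrite -[X in _ --> X]mul1r.
rewrite (_ : (fun n => _) = fun n => qexp (z * q ^+ n) / qexp z).
  by apply: cvgMr_tmp; exact: cvg_qexp1.
by apply/funext => n; rewrite qexp_shiftn// mulfK// qexp_neq0.
Qed.

End euler.

(** * Rearrangement of iterated series *)

Section rearrangement.
Context {V : nmodType}.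

(** Moves the triangular shape from the ranges into a test on the summand, the form to which
    dominated convergence applies. *)
Lemma sum_triangle N (F : nat -> nat -> V) :
  \sum_(n < N) \sum_(k < n.+1) F k (n - k)%N
  = \sum_(a < N) \sum_(b < N) if (a + b < N)%N then F a b else 0.
Proof.
transitivity (\sum_(n < N) \sum_(a < N) \sum_(b < N) if (a + b == n)%N then F a b else 0).
  apply: eq_bigr => n _; rewrite (big_ord_widen _ (fun a => F a (n - a)%N) (ltn_ord n)).
  rewrite big_mkcond/=; apply: eq_bigr => a _; rewrite ltnS.
  rewrite -big_mkcond/=; case: ifPn => an.
    rewrite (eq_bigl (fun b : 'I_N => b == (n - a)%N :> nat)).
      by rewrite big_ord1_eq (leq_ltn_trans (leq_subr _ _)).
    by move=> b; apply/eqP/eqP; lia.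
  by rewrite big1// => b /eqP nE; move: an; rewrite -nE leq_addr.
rewrite exchange_big/=; apply: eq_bigr => a _; rewrite exchange_big/=.
apply: eq_bigr => b _; rewrite -big_mkcond/=.
rewrite (eq_bigl (fun n : 'I_N => n == (a + b)%N :> nat)); last by move=> n; rewrite eq_sym.
by rewrite (big_ord1_eq _ (fun=> F a b)).
Qed.

(** [sum_triangle] is used three times: on n = k + i, then on i = p + s, then on k = j + l. *)
Lemma sum_triangle4 N (T : nat -> nat -> nat -> nat -> V) :
  \sum_(n < N) \sum_(k < n.+1) \sum_(j < k.+1) \sum_(p < (n - k).+1)
     T j p (k - j)%N (n - k - p)%N
  = \sum_(j < N) \sum_(p < N) \sum_(l < N) \sum_(s < N)
     if (j + p + l + s < N)%N then T j p l s else 0.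
Proof.
rewrite (sum_triangle _ (fun k i =>
  \sum_(j < k.+1) \sum_(p < i.+1) T j p (k - j)%N (i - p)%N)).
(* [k] stays separate from j + l so that [X] fits the last use of [sum_triangle], where k = j + l is
   substituted. *)
pose X k j l := \sum_(p < N) \sum_(s < N) if (k + p + s < N)%N then T j p l s else 0.
transitivity (\sum_(k < N) \sum_(j < k.+1) X (j + (k - j))%N j (k - j)%N).
  apply: eq_bigr => k _; transitivity (\sum_(i < N) \sum_(j < k.+1)
    if (k + i < N)%N then \sum_(p < i.+1) T j p (k - j)%N (i - p)%N else 0).
    by apply: eq_bigr => i _; case: ifP => // _; rewrite big1.
  rewrite exchange_big/=; apply: eq_bigr => j _.
  rewrite subnKC; last by rewrite -ltnS.
  transitivity (\sum_(i < N) \sum_(p < i.+1)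
    if (k + p + (i - p) < N)%N then T j p (k - j)%N (i - p)%N else 0).
    apply: eq_bigr => i _; case: ifPn => h.
      apply: eq_bigr => p _; have := ltn_ord p; rewrite ltnS => pi.
      by rewrite -addnA subnKC// h.
    rewrite big1// => p _; have := ltn_ord p; rewrite ltnS => pi.
    by rewrite -addnA subnKC// (negbTE h).
  rewrite (sum_triangle _ (fun p s => if (k + p + s < N)%N then T j p (k - j)%N s else 0)).
  apply: eq_bigr => p _; apply: eq_bigr => s _.
  by case: ifPn => // h; case: ifPn => // h'; exfalso; move/negP : h; apply; lia.
rewrite (sum_triangle _ (fun j l => X (j + l)%N j l)); apply: eq_bigr => j _.
rewrite [RHS]exchange_big/=; apply: eq_bigr => l _; rewrite /X; case: ifPn => h.
  by apply: eq_bigr => p _; apply: eq_bigr => s _; rewrite (addnAC j p l).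
rewrite big1// => p _; rewrite big1// => s _.
by case: ifPn => // h'; exfalso; move/negP : h; apply; lia.
Qed.

End rearrangement.

(** * Dominated convergence of double and quadruple sums *)

Lemma norm_sum_geo2 (R : realType) (K r : Cplx R) (u : nat -> nat -> Cplx R) :
  0 <= r -> r < 1 -> (forall l s, `|u l s| <= K * r ^+ l * r ^+ s) ->
  forall N M, `|\sum_(l < N) \sum_(s < M) u l s| <= K / (1 - r) / (1 - r).
Proof.
move=> r0 r1 uK N M.
apply: (norm_sum_geo (u := fun l => \sum_(s < M) u l s)) => // l.
by rewrite mulrAC; apply: (norm_sum_geo (u := u l)).
Qed.

(** [tannery] in [p] for each fixed [j], then in [j], where the inner sums are dominated with
    constant K/(1 - r). *)
Lemma tannery2 (R : realType) (K r : Cplx R) (f : nat -> nat -> nat -> Cplx R)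
    (g : nat -> nat -> Cplx R) :
  0 <= r -> r < 1 -> (forall N j p, `|f N j p| <= K * r ^+ j * r ^+ p) ->
  (forall j p, f N j p @[N --> \oo] --> g j p) ->
  \sum_(j < N) \sum_(p < N) f N j p @[N --> \oo]
    --> limn (fun N => \sum_(j < N) limn (fun M => \sum_(p < M) g j p)).
Proof.
move=> r0 r1 fK fg.
apply: (tannery (K := K / (1 - r)) (f := fun N j => \sum_(p < N) f N j p)
  (g := fun j => limn (fun M => \sum_(p < M) g j p)) r0 r1) => [N j|j].
  by rewrite mulrAC; apply: (norm_sum_geo (u := f N j)).
by apply: (tannery (f := fun N => f N j) (g := g j) r0 r1) => // N p; exact: fK.
Qed.

Lemma cvg_if_ltn (R : realType) m (x : Cplx R) :
  (if (m < N)%N then x else 0) @[N --> \oo] --> x.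
Proof.
apply: cvg_near_cst; near=> N; rewrite ifT//.
by near: N; exact: nbhs_infty_gt.
Unshelve. all: by end_near. Qed.

Lemma cvg_triangle2 (R : realType) (K r : Cplx R) (T : nat -> nat -> Cplx R) :
  0 <= r -> r < 1 -> (forall j p, `|T j p| <= K * r ^+ j * r ^+ p) ->
  \sum_(j < N) \sum_(p < N) (if (j + p < N)%N then T j p else 0) @[N --> \oo]
    --> limn (fun N => \sum_(j < N) limn (fun M => \sum_(p < M) T j p)).
Proof.
move=> r0 r1 TK; apply: (tannery2
  (f := fun N j p => if (j + p < N)%N then T j p else 0) (g := T) r0 r1) => [N j p|j p].
  by case: ifP => // _; rewrite normr0 (le_trans _ (TK j p)).
exact: cvg_if_ltn.
Qed.

(** [tannery2] in (l, s) for fixed (j, p), then in (j, p) with constant K/(1 - r)^2. The cutoff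
    preserves the domination and is eventually inactive at each index. *)
Lemma cvg_triangle4 (R : realType) (K r : Cplx R) (T : nat -> nat -> nat -> nat -> Cplx R) :
  0 <= r -> r < 1 ->
  (forall j p l s, `|T j p l s| <= K * r ^+ j * r ^+ p * r ^+ l * r ^+ s) ->
  \sum_(j < N) \sum_(p < N) \sum_(l < N) \sum_(s < N)
    (if (j + p + l + s < N)%N then T j p l s else 0) @[N --> \oo]
    --> limn (fun N => \sum_(j < N) limn (fun N => \sum_(p < N)
          limn (fun N => \sum_(l < N) limn (fun M => \sum_(s < M) T j p l s)))).
Proof.
move=> r0 r1 TK; pose f N j p l s := if (j + p + l + s < N)%N then T j p l s else 0.
have fK N j p l s : `|f N j p l s| <= K * r ^+ j * r ^+ p * r ^+ l * r ^+ s.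
  by rewrite /f; case: ifP => // _; rewrite normr0 (le_trans _ (TK j p l s)).
apply: (tannery2 (K := K / (1 - r) / (1 - r))
  (f := fun N j p => \sum_(l < N) \sum_(s < N) f N j p l s)
  (g := fun j p => limn (fun N => \sum_(l < N) limn (fun M => \sum_(s < M) T j p l s))) r0 r1) => [N j p|j p].
  have -> : K / (1 - r) / (1 - r) * r ^+ j * r ^+ p
    = K * r ^+ j * r ^+ p / (1 - r) / (1 - r) by ring.
  by apply: (norm_sum_geo2 (u := f N j p)).
apply: (tannery2 (f := fun N => f N j p) (g := T j p) r0 r1) => [N l s|l s]; first exact: fK.
exact: cvg_if_ltn.
Qed.

(** * Scaling of series and uniform bounds *)

Lemma limn_sumZ (R : realType) (c : Cplx R) (u : nat -> Cplx R) :
  cvgn (fun N => \sum_(l < N) u l) ->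
  limn (fun N => \sum_(l < N) c * u l) = c * limn (fun N => \sum_(l < N) u l).
Proof.
move=> cu; apply: limn_unique; under eq_cvg do rewrite -mulr_sumr.
exact: cvgMl_tmp.
Qed.

(** Needs an argument because the order on [Cplx R] is partial: norms are real, hence comparable. *)
Lemma le_max_normr (R : realType) (x y : Cplx R) :
  (`|x| <= Num.max `|x| `|y|) /\ (`|y| <= Num.max `|x| `|y|).
Proof.
have c : (`|x| >=< `|y|)%R by apply: real_comparable; exact: normr_real.
by rewrite !comparable_le_max// !lexx orbT.
Qed.

Lemma norm_mul3_le (R : realType) (a b t M N : Cplx R) :
  `|a| <= M -> `|b| <= N -> `|a * b * t| <= `|t| * M * N.
Proof.
move=> aM bN; rewrite !normrM mulrC mulrA.
have M0 := le_trans (normr_ge0 _) aM.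
by apply: ler_pM (mulr_ge0 _ _) _ _ bN => //; exact: ler_wpM2l.
Qed.

Lemma qratio_bounded (R : realType) (q a b c d e : Cplx R) :
  0 <= q -> q < 1 ->
  (forall m, 1 - d * q ^+ m != 0) -> (forall m, 1 - e * q ^+ m != 0) ->
  exists U : Cplx R, forall n,
    `|qpoch a q n * qpoch b q n * qpoch c q n / (qpoch d q n * qpoch e q n)| <= U.
Proof.
move=> q0 q1 hd he.
have [A hA] := qpoch_bounded a q0 q1; have [B hB] := qpoch_bounded b q0 q1.
have [C hC] := qpoch_bounded c q0 q1; have [D hD] := qpoch_inv_bounded q0 q1 hd.
have [E hE] := qpoch_inv_bounded q0 q1 he.
exists (A * B * C * (D * E)) => n; rewrite invfM !normrM.
by rewrite !ler_pM ?mulr_ge0.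
Qed.

Lemma norm_limn_geo (R : realType) (K r : Cplx R) (u : nat -> Cplx R) :
  0 <= r -> r < 1 -> (forall n, `|u n| <= K * r ^+ n) ->
  `|limn (fun N => \sum_(h < N) u h)| <= K / (1 - r).
Proof.
move=> r0 r1 uK; apply: norm_le_cvg (cvg_geo r0 r1 uK) _ => N.
exact: norm_sum_geo.
Qed.

(** * The quadruple series *)

Section quadruple_series.
Context {R : realType} (q x1 y1 x2 y2 t : Cplx R) (u v : nat -> Cplx R).
Hypotheses (q0 : 0 <= q) (q1 : q < 1).

(** The T(j,p,l,s) of the overview, for arbitrary coefficient sequences [u] and [v]. *)
Definition quad_term (j p l s : nat) : Cplx R :=
  u (j + l)%N * v (j + p)%N * x1 ^+ (p + s) * y1 ^+ (j + l)
  * x2 ^+ (l + s) * y2 ^+ (j + p) * t ^+ (j + p + l + s) * q ^+ (j * s)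
  / (qpoch q q j * qpoch q q p * qpoch q q l * qpoch q q s).

Let qqn0 n : qpoch q q n != 0.
Proof. exact: qpoch_neq0 (qq_neq0 q0 q1) n. Qed.

(** After the q-Vandermonde expansion, the factors (q;q)_n, (q;q)_k and (q;q)_(n-k) cancel, leaving
    the four denominators of [quad_term]. *)
Lemma sum_quad_term n :
  (\sum_(k < n.+1) qbinom q n k * u k * x1 ^+ (n - k) * y1 ^+ k)
  * (\sum_(k < n.+1) qbinom q n k * v k * x2 ^+ (n - k) * y2 ^+ k)
  * t ^+ n / qpoch q q n
  = \sum_(k < n.+1) \sum_(j < k.+1) \sum_(p < (n - k).+1)
      quad_term j p (k - j) (n - k - p).
Proof.
rewrite -2!mulrA mulr_suml; apply: eq_bigr => k _.
have kn : (k <= n)%N by rewrite -ltnS.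
have -> : \sum_(m < n.+1) qbinom q n m * v m * x2 ^+ (n - m) * y2 ^+ m
  = \sum_(j < k.+1) \sum_(p < (n - k).+1)
      qbinom q k j * qbinom q (n - k) p * q ^+ (j * (n - k - p))
      * (v (j + p)%N * x2 ^+ (n - (j + p)) * y2 ^+ (j + p)).
  rewrite -(qbinom_vandermonde qqn0 k (n - k)
    (fun m => v m * x2 ^+ (n - m) * y2 ^+ m)).
  by rewrite subnKC//; apply: eq_bigr => m _; rewrite !mulrA.
rewrite mulr_suml mulr_sumr; apply: eq_bigr => j _.
rewrite mulr_suml mulr_sumr; apply: eq_bigr => p _.
have := ltn_ord j; have := ltn_ord p; rewrite !ltnS.
move: (nat_of_ord j) (nat_of_ord p) => {}j {}p pnk jk.
(* Passage to the free indices l = k - j and s = n - k - p, which removes all subtractions. *)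
have [l kE] : exists l, nat_of_ord k = (j + l)%N by exists (k - j)%N; lia.
have [s nkE] : exists s, (n - k = p + s)%N by exists (n - k - p)%N; lia.
have nE : n = (j + p + l + s)%N by lia.
have -> : (n - (j + p) = l + s)%N by lia.
rewrite nkE kE (_ : j + l - j = l)%N; last by lia.
rewrite (_ : p + s - p = s)%N; last by lia.
rewrite /quad_term /qbinom -nE -kE nkE.
rewrite (_ : k - j = l)%N; last by lia.
rewrite (_ : p + s - p = s)%N; last by lia.
field.
by rewrite !qqn0.
Qed.

(** The exponents of x1 and y1 add up to the total degree j + p + l + s, and so do those of x2 and
    y2; this gives the powers of r. The factor q^(js) is at most 1, and [A] bounds each
    1/(q;q)_n. *)
Lemma norm_quad_term (U W : Cplx R) :
  (forall n, `|u n| <= U) -> (forall n, `|v n| <= W) ->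
  exists K : Cplx R, forall j p l s,
    let r := `|t| * Num.max `|x1| `|y1| * Num.max `|x2| `|y2| in
    `|quad_term j p l s| <= K * r ^+ j * r ^+ p * r ^+ l * r ^+ s.
Proof.
move=> uU vW; have [A hA] := qpoch_inv_bounded q0 q1 (qq_neq0 q0 q1).
have [x1M y1M] := le_max_normr x1 y1; have [x2M y2M] := le_max_normr x2 y2.
exists (U * W * (A * A * A * A)) => j p l s; cbv zeta.
move: (Num.max _ _) (Num.max _ _) x1M y1M x2M y2M => N M x1M y1M x2M y2M.
have M0 := le_trans (normr_ge0 _) x1M; have N0 := le_trans (normr_ge0 _) x2M.
have U0 := le_trans (normr_ge0 _) (uU 0%N); have W0 := le_trans (normr_ge0 _) (vW 0%N).
have A0 := le_trans (normr_ge0 _) (hA 0%N).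
apply: (@le_trans _ _ (U * W * M ^+ (p + s) * M ^+ (j + l) * N ^+ (l + s) * N ^+ (j + p)
  * `|t| ^+ (j + p + l + s) * 1 * (A * A * A * A))).
  rewrite /quad_term !invfM !normrM !normrX (ger0_norm q0).
  rewrite !ler_pM ?mulr_ge0 ?exprn_ge0// ?exprn_ile1 ?(ltW q1)//;
    by rewrite lerXn2r ?nnegrE.
rewrite le_eqVlt; apply/orP; left; apply/eqP.
by rewrite !exprMn !exprD; ring.
Qed.

Hypothesis z1 : `|x1 * x2 * t| < 1.

Lemma limn_quad_term j p l :
  limn (fun N => \sum_(s < N) quad_term j p l s)
  = v (j + p)%N * x1 ^+ p * y1 ^+ j * y2 ^+ (j + p) * t ^+ (j + p)
    * qpoch (x1 * x2 * t) q j / (qpoch q q j * qpoch q q p) * qexp q (x1 * x2 * t)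
    * (u (j + l)%N * (x2 * y1 * t) ^+ l / qpoch q q l).
Proof.
(* [c] collects the factors free of [s]; what remains is Euler's series at x1 x2 t q^j. *)
pose c := u (j + l)%N * v (j + p)%N * x1 ^+ p * y1 ^+ (j + l)
  * x2 ^+ l * y2 ^+ (j + p) * t ^+ (j + p + l) / (qpoch q q j * qpoch q q p * qpoch q q l).
transitivity (c * qexp q (x1 * x2 * t * q ^+ j)).
  rewrite /qexp -(limn_sumZ c (u := fun s => (x1 * x2 * t * q ^+ j) ^+ s / qpoch q q s)).
    congr (limn _); apply/funext => N; apply: eq_bigr => s _.
    rewrite /c /quad_term !exprMn !exprD -exprM; field.
    by rewrite !qqn0.
  apply/cvg_ex; exists (qexp q (x1 * x2 * t * q ^+ j)).
  by apply: cvg_qexp => //; exact: norm_mul_expr_lt1.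
rewrite qexp_shiftn// /c !exprMn !exprD; field.
by rewrite !qqn0.
Qed.

End quadruple_series.

(** * Both sides as the same iterated series *)

Theorem theorem6 (R : realType) (q : R)
  (a1 b1 c1 d1 e1 x1 y1 a2 b2 c2 d2 e2 x2 y2 t : Cplx R) :
  0 < q -> q < 1 ->
  not_qneg_pow q%:C d1 -> not_qneg_pow q%:C e1 ->
  not_qneg_pow q%:C d2 -> not_qneg_pow q%:C e2 ->
  x1 != 0 ->
  `|t| * Num.max `|x1| `|y1| * Num.max `|x2| `|y2| < 1 ->
  let Q := q%:C in
  (* innermost series over l, for each j *)
  let inner (j l : nat) :=
    (qpoch (a1 * Q ^+ j) Q l * qpoch (b1 * Q ^+ j) Q l * qpoch (c1 * Q ^+ j) Q l)
    / (qpoch Q Q l * qpoch (d1 * Q ^+ j) Q l * qpoch (e1 * Q ^+ j) Q l)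
    * (x2 * y1 * t) ^+ l in
  let inner_sum (j : nat) := limn (fun L => \sum_(l < L) inner j l) in
  let lhs_term (n : nat) :=
    qphi a1 b1 c1 d1 e1 x1 y1 Q n * qphi a2 b2 c2 d2 e2 x2 y2 Q n
    * t ^+ n / qpoch Q Q n in
  let rhs_term (n : nat) :=
    (qpoch a2 Q n * qpoch b2 Q n * qpoch c2 Q n) * (x1 * y2 * t) ^+ n
    / (qpoch Q Q n * qpoch d2 Q n * qpoch e2 Q n)
    * \sum_(j < n.+1)
        (qpoch (Q ^+ (n - j).+1) Q j * qpoch (x1 * x2 * t) Q j
           * qpoch a1 Q j * qpoch b1 Q j * qpoch c1 Q j)
        / (qpoch Q Q j * qpoch d1 Q j * qpoch e1 Q j)
        * (y1 / x1) ^+ j * inner_sum j in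
  [/\ forall j : nat, cvgn (fun L => \sum_(l < L) inner j l),
      cvgn (fun N => \sum_(n < N) lhs_term n),
      cvgn (fun N => \sum_(n < N) rhs_term n) &
      limn (fun N => \sum_(n < N) lhs_term n)
      = (qpoch_inf (x1 * x2 * t) Q)^-1 * limn (fun N => \sum_(n < N) rhs_term n)].
Proof.
move=> q_gt0 q_lt1 hd1 he1 hd2 he2 x1_neq0 r1 Q inner inner_sum lhs_term rhs_term.
have q0 : 0 <= Q by rewrite ler0c ltW.
have q1 : Q < 1 by rewrite ltcR.
have Q_neq0 : Q != 0 by rewrite gt_eqF// ltcR.
have nd1 := not_qneg_pow_neq0 Q_neq0 hd1; have ne1 := not_qneg_pow_neq0 Q_neq0 he1.
have nd2 := not_qneg_pow_neq0 Q_neq0 hd2; have ne2 := not_qneg_pow_neq0 Q_neq0 he2.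
have qqn0 : forall n, qpoch Q Q n != 0 := qpoch_neq0 (qq_neq0 q0 q1).
have [x1M y1M] := le_max_normr x1 y1; have [x2M y2M] := le_max_normr x2 y2.
have z1 : `|x1 * x2 * t| < 1 := le_lt_trans (norm_mul3_le t x1M x2M) r1.
have w1 : `|x2 * y1 * t| < 1.
  by rewrite (mulrC x2); exact: le_lt_trans (norm_mul3_le t y1M x2M) r1.
have r0 := le_trans (normr_ge0 _) (norm_mul3_le t x1M x2M).
pose u k := qpoch a1 Q k * qpoch b1 Q k * qpoch c1 Q k / (qpoch d1 Q k * qpoch e1 Q k).
pose v k := qpoch a2 Q k * qpoch b2 Q k * qpoch c2 Q k / (qpoch d2 Q k * qpoch e2 Q k).
have [U uU] : exists U : Cplx R, forall n, `|u n| <= U by exact: qratio_bounded.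
have [W vW] : exists W : Cplx R, forall n, `|v n| <= W by exact: qratio_bounded.
have [K quadK] := norm_quad_term x1 y1 x2 y2 t q0 q1 uU vW.
cbv zeta in quadK.
(* The product of |t| and the two maxima is abstracted to a ratio [r] with 0 <= r < 1. *)
move: (_ * _ * _) r0 r1 quadK => r r0 r1 quadK.
pose T := quad_term Q x1 y1 x2 y2 t u v.
have innerC j : cvgn (fun L => \sum_(l < L) inner j l).
  have shift d : (forall m, 1 - d * Q ^+ m != 0) -> forall m, 1 - d * Q ^+ j * Q ^+ m != 0.
    by move=> hd m; rewrite -mulrA -exprD.
  have [B hB] := qratio_bounded (a1 * Q ^+ j) (b1 * Q ^+ j) (c1 * Q ^+ j) q0 q1
    (shift _ nd1) (shift _ ne1).
  have [A hA] := qpoch_inv_bounded q0 q1 (qq_neq0 q0 q1).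
  apply: (cvg_geo (K := B * A) (u := inner j) (normr_ge0 _) w1) => l.
  rewrite /inner normrM normrX ler_wpM2r ?exprn_ge0//.
  rewrite -(mulrA (qpoch Q Q l)) invfM (mulrC (qpoch Q Q l)^-1) mulrA normrM.
  by rewrite ler_pM.
(* [S] is the sum over (l, s), the common building block of both sides. *)
pose S j p := limn (fun N => \sum_(l < N) limn (fun M => \sum_(s < M) T j p l s)).
have SK j p : `|S j p| <= K / (1 - r) / (1 - r) * r ^+ j * r ^+ p.
  have -> : K / (1 - r) / (1 - r) * r ^+ j * r ^+ p
    = K * r ^+ j * r ^+ p / (1 - r) / (1 - r) by ring.
  apply: (norm_limn_geo (u := fun l => limn (fun M => \sum_(s < M) T j p l s))) => // l.
  by rewrite mulrAC; apply: (norm_limn_geo (u := T j p l)).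
have lhsC : \sum_(n < N) lhs_term n @[N --> \oo]
    --> limn (fun N => \sum_(j < N) limn (fun M => \sum_(p < M) S j p)).
  have := cvg_triangle4 r0 r1 quadK.
  under eq_cvg do rewrite -sum_triangle4.
  rewrite (_ : (fun N => \sum_(n < N) lhs_term n) = fun N =>
    \sum_(n < N) \sum_(k < n.+1) \sum_(j < k.+1) \sum_(p < (n - k).+1)
      T j p (k - j)%N (n - k - p)%N)//.
  apply/funext => N; apply: eq_bigr => n _; rewrite -sum_quad_term//.
  by rewrite /lhs_term /qphi; congr (_ * _ * _ / _); apply: eq_bigr => k _;
    rewrite !mulrA.
(* Each (a;q)_(j+l) splits as (a;q)_j (a q^j;q)_l, which separates u_j from the inner series. *)
have innerE j l : u (j + l)%N * (x2 * y1 * t) ^+ l / qpoch Q Q l = u j * inner j l.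
  have := qpoch_neq0 nd1 (j + l)%N; have := qpoch_neq0 ne1 (j + l)%N.
  rewrite /u /inner !qpochD !mulf_eq0 !negb_or => /andP[ej el] /andP[dj dl]; field.
  by rewrite ej el dj dl qqn0.
have SE j p : S j p = v (j + p)%N * x1 ^+ p * y1 ^+ j * y2 ^+ (j + p) * t ^+ (j + p)
    * qpoch (x1 * x2 * t) Q j / (qpoch Q Q j * qpoch Q Q p) * qexp Q (x1 * x2 * t)
    * u j * inner_sum j.
  rewrite /S -(limn_sumZ _ (innerC j)); congr (limn _); apply/funext => N.
  by apply: eq_bigr => l _; rewrite limn_quad_term// innerE mulrA.
(* An exact identity of partial sums on the diagonals n = j + p. Here x1 != 0 gives x1^n (y1/x1)^j =
   x1^p y1^j. *)
have rhsE N : qexp Q (x1 * x2 * t) * \sum_(n < N) rhs_term n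
    = \sum_(j < N) \sum_(p < N) if (j + p < N)%N then S j p else 0.
  rewrite -sum_triangle mulr_sumr; apply: eq_bigr => n _.
  rewrite /rhs_term 2!mulr_sumr; apply: eq_bigr => j _.
  have := ltn_ord j; rewrite ltnS; move: (nat_of_ord j) => {}j jn.
  have [p nE] : exists p, nat_of_ord n = (p + j)%N by exists (n - j)%N; rewrite subnK.
  rewrite SE nE addnK (addnC j p).
  (* This factor turns the denominator (q;q)_n into the (q;q)_p of [S]. *)
  have -> : qpoch (Q ^+ p.+1) Q j = qpoch Q Q (p + j) / qpoch Q Q p.
    by rewrite qpochD exprS mulrAC divff// mul1r.
  rewrite /u /v !exprMn !exprD exprVn; field.
  by rewrite !qqn0 !qpoch_neq0// expf_neq0.
have F0 := qexp_neq0 q0 q1 z1.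
have rhsC : \sum_(n < N) rhs_term n @[N --> \oo] --> (qexp Q (x1 * x2 * t))^-1
    * limn (fun N => \sum_(j < N) limn (fun M => \sum_(p < M) S j p)).
  rewrite (_ : (fun N => _) = fun N => (qexp Q (x1 * x2 * t))^-1
    * \sum_(j < N) \sum_(p < N) if (j + p < N)%N then S j p else 0).
    by apply: cvgMl_tmp; exact: cvg_triangle2 SK.
  by apply/funext => N; rewrite -rhsE mulKf.
split.
- exact: innerC.
- by apply/cvg_ex; eexists; exact: lhsC.
- by apply/cvg_ex; eexists; exact: rhsC.
- rewrite (limn_unique lhsC) (limn_unique rhsC) (qpoch_infE q0 q1 z1).
  by rewrite (mulVKf F0).
Qed.
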